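(* Let $d\geq 2$, let $R>0$, and let $\Lambda\subset\mathbb{R}^d$ be a Delone set of finite local complexity. Then: (a) The set $\mathcal{D}_{<R}(\Lambda)$ is determined by two $X$-rays in $\Lambda$-directions. (b) The set $\mathcal{D}_{<R}(\Lambda)$ is determined by two projections on orthogonal complements of $1$-dimensional $\Lambda$-subspaces.
   Context: A Delone set $\Lambda\subset\mathbb{R}^d$ is a set that is uniformly discrete (there is $r>0$ such that every open ball of radius $r$ contains at most one point of $\Lambda$) and relatively dense (there is $\rho>0$ such that every open ball of radius $\rho$ contains at least one point of $\Lambda$). $\Lambda$ has finite local complexity if $\Lambda-\Lambda=\{x-y : x,y\in\Lambda\}$ is closed and discrete. $\mathcal{D}_{<R}(\Lambda)$ is the set of all subsets of $\Lambda$ of diameter less than $R$ (these are finite sets). A direction is an element of the unit sphere $\mathbb{S}^{d-1}$. A $\Lambda$-direction is a direction parallel to a non-zero element of $\Lambda-\Lambda$; a $\Lambda$-subspace is a linear subspace of $\mathbb{R}^d$ generated by elements of $\Lambda-\Lambda$. For a finite $F\subset\mathbb{R}^d$ and a direction $u$, the $X$-ray $X_uF$ is the function assigning to each line $\ell$ in $\mathbb{R}^d$ parallel to $u$ the number $\operatorname{card}(F\cap\ell)$. For a linear subspace $T$, $F|T^\perp$ denotes the orthogonal projection (canonical inner product) of $F$ on $T^\perp$. A collection $\mathcal{E}$ of finite subsets of $\mathbb{R}^d$ is determined by $m$ $X$-rays in $\Lambda$-directions if there is a set $U$ of $m$ pairwise non-parallel $\Lambda$-directions such that for all $F,F'\in\mathcal{E}$: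 $(X_uF=X_uF'\ \forall u\in U)\Rightarrow F=F'$. It is determined by $m$ projections on orthogonal complements of $1$-dimensional $\Lambda$-subspaces if there is a set $\mathcal{T}$ of $m$ pairwise non-parallel $1$-dimensional $\Lambda$-subspaces such that for all $F,F'\in\mathcal{E}$: $(F|T^\perp=F'|T^\perp\ \forall T\in\mathcal{T})\Rightarrow F=F'$. *)

(* Defs.v *)
(* R^d is represented by row vectors 'rV[R]_d over R : realType. *)
From HB Require Import structures.
From mathcomp Require Import all_boot all_order all_algebra finmap.
From mathcomp Require Import all_classical all_reals all_analysis.

Set Implicit Arguments.
Unset Strict Implicit.
Unset Printing Implicit Defensive.

Import Order.TTheory GRing.Theory Num.Theory.
Import numFieldNormedType.Exports.

Local Open Scope classical_set_scope.
Local Open Scope ring_scope.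

Section Euclidean.
Context {R : realType} {d : nat}.
Notation V := 'rV[R]_d.
Implicit Types (x y u v w : V) (A L F : set V) (E : set (set V)).

Definition dot u v : R := (u *m v^T) 0 0.

(* The library norm `|x| on row vectors is the sup norm; it induces the same
   topology as enorm but not the same balls and diameters. *)
Definition enorm x : R := Num.sqrt (dot x x).

Definition eball x (r : R) : set V := [set y | enorm (y - x) < r].

(* The supremum is taken in \bar R, so an unbounded set has diameter +oo
   (and set0 has diameter -oo). *)
Definition diam A : \bar R :=
  ereal_sup [set (enorm (x - y))%:E | x in A & y in A].

Definition uniformly_discrete L :=
  exists2 r : R, 0 < r &
    forall c x y, (L `&` eball c r) x -> (L `&` eball c r) y -> x = y.

Definition relatively_dense L :=
  exists2 rho : R, 0 < rho & forall c, L `&` eball c rho !=set0.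

Definition Delone L := uniformly_discrete L /\ relatively_dense L.

Definition diffset L : set V := [set x - y | x in L & y in L].

(* [A `<=` isolated A]: A is discrete in its subspace topology. *)
Definition finite_local_complexity L :=
  closed (diffset L) /\ diffset L `<=` isolated (diffset L).

Definition subsets_diam_lt (D : R) L : set (set V) :=
  [set F | F `<=` L /\ (diam F < D%:E)%E].

Definition direction u := enorm u = 1.

(* Meant for nonzero vectors only. *)
Definition parallel u v := exists2 c : R, c != 0 & v = c *: u.

Definition L_direction L u :=
  direction u /\ exists w, [/\ diffset L w, w != 0 & parallel u w].

Definition line_through x u : set V := [set x + t *: u | t in [set: R]].

Definition parallel_line u := {l : set V | exists x, l = line_through x u}.

(* fset_set sends infinite sets to fset0, so this is the cardinality of
   F `&` l only when that set is finite. *)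
Definition Xray u F : parallel_line u -> nat :=
  fun l => #|` fset_set (F `&` sval l) |.

Definition determined_by_Xrays (m : nat) L E :=
  exists U : set V,
    [/\ (U #= `I_m)%card,
        (forall u, U u -> L_direction L u),
        (forall u v, U u -> U v -> u <> v -> ~ parallel u v) &
        forall F F', E F -> E F' ->
          (forall u, U u -> Xray (u := u) F = Xray F') -> F = F'].

(* Since {vspace V} is finite-dimensional, generation by finitely many elements
   of diffset L is the same as generation by an arbitrary subset of it. *)
Definition L_subspace L (T : {vspace V}) :=
  exists2 X : seq V, (forall x, x \in X -> diffset L x) & T = <<X>>%VS.

Definition parallel_subspaces (S T : {vspace V}) := (S <= T)%VS || (T <= S)%VS.

Definition orthocompl (T : {vspace V}) : set V :=
  [set y | forall x, x \in T -> dot x y = 0].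

(* Image of F under the orthogonal projection onto the linear subspace S: the
   projection of x is the point p of S such that x - p is orthogonal to S. *)
Definition oproj F (S : set V) : set V :=
  [set p | S p /\ exists2 x, F x & forall s, S s -> dot (x - p) s = 0].

Definition determined_by_projections (m : nat) L E :=
  exists TT : set {vspace V},
    [/\ (TT #= `I_m)%card,
        (forall T, TT T -> L_subspace L T /\ \dim T = 1%N),
        (forall S T, TT S -> TT T -> S <> T -> ~~ parallel_subspaces S T) &
        forall F F', E F -> E F' ->
          (forall T, TT T -> oproj F (orthocompl T) = oproj F' (orthocompl T)) ->
          F = F'].

End Euclidean.

(* Main.v *)
Require Import Defs.
From mathcomp Require Import all_boot all_order all_algebra.
From mathcomp Require Import all_classical all_reals all_analysis.
From mathcomp Require Import finmap ring lra.

Set Implicit Arguments.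
Unset Strict Implicit.
Unset Printing Implicit Defensive.

Import Order.TTheory GRing.Theory Num.Theory.
Import numFieldNormedType.Exports.

Local Open Scope classical_set_scope.
Local Open Scope ring_scope.

(** Suppose that [F] and [G] have the same shadow (set of lines met) along two
    non-parallel directions [v] and [w].  Starting from [x] in [F], there are
    points [x + s *: v] and [x + t *: w] in [G].  They are less than [D] apart,
    because [G] has diameter less than [D]; measuring their difference along a
    unit vector [e] orthogonal to [v] kills [s *: v] and leaves
    [`|dot (t *: w) e| < D].  So if every non-zero element of [L - L] on the
    line spanned by [w] has [e]-component at least [D] in absolute value, then
    [t = 0] and [x] lies in [G].  By symmetry [F = G] ([two_shadows_sub]).

    The work is in finding such a [w] once a non-zero [v] in [L - L] is fixed
    ([sparse_difference]).  We look for [w] in [L - L] with sup norm at most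
    five times its [e]-component.  Then a multiple of [w] in [L - L] violating
    the requirement has sup norm less than [5 * D], and by finite local
    complexity there are only finitely many such elements [b], hence finitely many slopes
    [dot b u / dot b e], where [u] is the unit vector along [v].
    Choose a slope [s] in [0, 1] at positive distance from all of them.  By
    relative density, [L - L] has a point [w] within a fixed distance of
    [N *: e + (N * s) *: u], and for large [N] its slope is too close to [s] to
    be one of the forbidden ones.

    The same [v] and [w] serve both parts of the theorem, since equal X-rays of
    finite sets ([Xray_shadow_sub]) and equal projections
    ([oproj_shadow_sub]) each yield equal shadows. *)

(** * Finite sets *)

Lemma card_eq_set2 (T : choiceType) (x y : T) :
  x != y -> ([set x; y] #= `I_2)%card.
Proof.
move=> xy; have -> : [set x; y] = [set` [fset x; y]%fset].
  apply/seteqP; split=> z /=; rewrite !inE.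
    by case=> ->; rewrite eqxx ?orbT.
  by case/orP => /eqP; [left|right].
by apply/card_eq_fsetP; rewrite cardfs2 xy.
Qed.

(** Neighbourhoods isolating the points of [A] form an open cover in which each
    member covers one point only. *)
Lemma compact_isolated_finite (T : ptopologicalType) (A : set T) :
  compact A -> A `<=` isolated A -> finite_set A.
Proof.
rewrite compact_cover => Acov Aiso.
have /choice[V VA] (x : T) : exists W : set T,
    A x -> open_nbhs x W /\ W `&` A = [set x].
  have [Ax|nAx] := pselect (A x); last by exists setT.
  have [_ [V /= + VA]] := Aiso x Ax; rewrite nbhsE => -[W oW WV].
  exists W => _; split=> //; apply/seteqP; split=> [y [Wy Ay]|y ->].
    by rewrite -VA; split=> //; exact: WV.
  by split=> //; case: oW.
have [x Ax|x Ax|D' D'A AD'] := Acov T A V.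
- by case: (VA x Ax) => -[].
- by exists x => //; case: (VA x Ax) => -[].
apply: sub_finite_set (finite_fset D') => y Ay.
have [x xD' Vxy] := AD' y Ay.
have [_ /seteqP[/(_ y)]] := VA x (set_mem (D'A x xD')).
by move=> /(_ (conj Vxy Ay)) -> _.
Qed.

(** The candidates for [s] are the numbers [1 / (n + 1)]: being infinitely many,
    they are not all in [S], and the complement of a finite set is open. *)
Lemma finite_set_gap (R : realType) (S : set R) : finite_set S ->
  exists s : R, [/\ 0 <= s, s <= 1 &
    exists2 del : R, 0 < del & forall x, S x -> del <= `|s - x|].
Proof.
move=> finS; have [n nS] : exists n : nat, ~ S n.+1%:R^-1.
  apply: contrapT => allS; apply: infinite_nat.
  apply: sub_finite_set (finite_preimage (f := fun n : nat => n.+1%:R^-1) _ finS).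
    by move=> n _; apply: contrapT => nS; apply: allS; exists n.
  by move=> m n _ _ /invr_inj/eqP; rewrite eqr_nat => /eqP[].
exists n.+1%:R^-1; split; rewrite ?invr_ge0 ?invf_le1 ?ler1n ?ler0n ?ltr0n //.
have : nbhs (n.+1%:R^-1 : R) (~` S).
  apply: open_nbhs_nbhs; split=> //; apply: closed_openC.
  by move: S finS {nS}; apply/accessible_finite_set_closed; exact: hausdorff_accessible.
case/nbhs_ballP => del /= del0 delS; exists del => // x Sx.
by rewrite leNgt; apply/negP => /delS.
Qed.

(** * Euclidean inner product and norm *)

Section Euclidean.
Context {R : realType} {d : nat}.
Implicit Types (x y u v w e : 'rV[R]_d) (L F G : set 'rV[R]_d) (a t D : R).

Lemma dotE u v : dot u v = \sum_j u 0 j * v 0 j.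
Proof. by rewrite /dot mxE; apply: eq_bigr => j _; rewrite mxE. Qed.

Lemma dotC u v : dot u v = dot v u.
Proof. by rewrite !dotE; apply: eq_bigr => j _; rewrite mulrC. Qed.

Lemma dotDl u v x : dot (u + v) x = dot u x + dot v x.
Proof. by rewrite /dot mulmxDl mxE. Qed.

Lemma dotZl a u x : dot (a *: u) x = a * dot u x.
Proof. by rewrite /dot -scalemxAl mxE. Qed.

Lemma dotBl u v x : dot (u - v) x = dot u x - dot v x.
Proof. by rewrite dotDl -scaleN1r dotZl mulN1r. Qed.

Lemma dotZr a x u : dot x (a *: u) = a * dot x u.
Proof. by rewrite dotC dotZl dotC. Qed.

Lemma dotBr x u v : dot x (u - v) = dot x u - dot x v.
Proof. by rewrite dotC dotBl !(dotC _ x). Qed.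

Lemma dot_ge0 x : 0 <= dot x x.
Proof. by rewrite dotE; apply: sumr_ge0 => j _; rewrite -expr2 sqr_ge0. Qed.

Lemma sqr_coord_le_dot x j : (x 0 j) ^+ 2 <= dot x x.
Proof.
rewrite dotE (bigD1 j) //= -expr2 lerDl.
by apply: sumr_ge0 => i _; rewrite -expr2 sqr_ge0.
Qed.

Lemma dot_eq0 x : dot x x = 0 -> x = 0.
Proof.
move=> x0; apply/rowP => j; rewrite mxE; apply/eqP.
by rewrite -sqrf_eq0 eq_le sqr_ge0 andbT -x0 sqr_coord_le_dot.
Qed.

Lemma sqr_enorm x : enorm x ^+ 2 = dot x x.
Proof. by rewrite /enorm sqr_sqrtr // dot_ge0. Qed.

Lemma enorm_ge0 x : 0 <= enorm x.
Proof. exact: sqrtr_ge0. Qed.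

Lemma enorm_neq0 x : x != 0 -> enorm x != 0.
Proof.
by apply: contraNneq => x0; apply/eqP/dot_eq0; rewrite -sqr_enorm x0 expr0n.
Qed.

Lemma enormZ a x : enorm (a *: x) = `|a| * enorm x.
Proof.
by rewrite /enorm dotZl dotZr mulrA -expr2 sqrtrM ?sqr_ge0 // sqrtr_sqr.
Qed.

Lemma direction_normalize x : x != 0 -> direction ((enorm x)^-1 *: x).
Proof.
move=> x0; rewrite /direction enormZ ger0_norm ?invr_ge0 ?enorm_ge0 //.
by rewrite mulVf // enorm_neq0.
Qed.

Lemma parallel_normalize x : x != 0 -> parallel x ((enorm x)^-1 *: x).
Proof. by move=> x0; exists (enorm x)^-1 => //; rewrite invr_eq0 enorm_neq0. Qed.

Lemma parallel_sym u v : parallel u v -> parallel v u.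
Proof.
by case=> c c0 ->; exists c^-1; rewrite ?invr_eq0 // scalerA mulVf // scale1r.
Qed.

(** Cauchy-Schwarz against a unit vector: the part of [x] orthogonal to [e] has
    non-negative square norm. *)
Lemma normr_dot_le x e : direction e -> `|dot x e| <= enorm x.
Proof.
move=> e1; rewrite -ler_sqr ?nnegrE ?enorm_ge0 // real_normK ?num_real //.
have ee : dot e e = 1 by rewrite -sqr_enorm e1 expr1n.
have := dot_ge0 (x - dot x e *: e).
rewrite dotBl !dotBr !dotZl !dotZr (dotC e x) ee sqr_enorm; nra.
Qed.

(** The left-hand side is the sup norm, for which closed bounded sets are known
    to be compact; this comparison transfers Euclidean bounds to it. *)
Lemma norm_le_enorm x : `|x| <= enorm x.
Proof.
rewrite [leLHS]mx_normrE; apply: bigmax_le => [|[i j] _ /=]; first exact: enorm_ge0.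
rewrite (ord1 i) -ler_sqr ?nnegrE ?enorm_ge0 // real_normK ?num_real //.
by rewrite sqr_enorm sqr_coord_le_dot.
Qed.

(** The orthogonal complement of [u] is a kernel of rank at least [d - 1]. *)
Lemma exists_orthogonal_direction u :
  (2 <= d)%N -> exists2 e, direction e & dot u e = 0.
Proof.
move=> d2; have : kermx u^T != 0.
  rewrite -mxrank_eq0 mxrank_ker -lt0n subn_gt0.
  by rewrite (leq_ltn_trans (rank_leq_col _)).
case/rowV0Pn => v /sub_kermxP vu v0; exists ((enorm v)^-1 *: v).
  exact: direction_normalize.
by rewrite dotZr dotC /dot vu mxE mulr0.
Qed.

Lemma enorm_lt_diam F D x y :
  (diam F < D%:E)%E -> F x -> F y -> enorm (x - y) < D.
Proof.
move=> FD Fx Fy; rewrite -lte_fin; apply: le_lt_trans FD.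
by apply: ereal_sup_ubound => /=; exists x => //; exists y.
Qed.

(** * Differences of points of [L] *)

Lemma finite_diffset_bounded L a :
  finite_local_complexity L -> finite_set (diffset L `&` [set x | `|x| <= a]).
Proof.
move=> [Lclosed Liso]; apply: compact_isolated_finite.
  apply: bounded_closed_compact.
    exists a; split; first exact: num_real.
    by move=> b ab x [_ /= xa]; rewrite (le_trans xa) // ltW.
  apply: closedI => //.
  exact: (closed_comp (fun x _ => @norm_continuous _ _ x) (@closed_le R a)).
move=> x [Lx xa]; have [_ [V Vx VL]] := Liso x Lx.
split; first exact/mem_set.
by exists V => //; rewrite setIA VL; apply/seteqP; split=> [y []|y ->].
Qed.

(** Translating [F] by one of its points puts it in a bounded part of [L - L]. *)
Lemma finite_subset_diam_lt L D F :
  finite_local_complexity L -> subsets_diam_lt D L F -> finite_set F.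
Proof.
move=> Lflc [FL FD]; have [->|/set0P[x0 Fx0]] := eqVneq F set0.
  exact: finite_set0.
have fin := finite_diffset_bounded D Lflc.
apply: sub_finite_set (finite_image (fun y => y + x0) fin) => x Fx /=.
exists (x - x0); last by rewrite subrK.
split; first by exists x; [exact: FL|exists x0 => //; exact: FL].
by rewrite /= (le_trans (norm_le_enorm _)) // ltW // (enorm_lt_diam FD).
Qed.

Lemma diffset_relatively_dense L : relatively_dense L ->
  exists2 rho : R, 0 < rho &
    forall z, exists2 w, diffset L w & enorm (w - z) < rho.
Proof.
case=> rho rho0 Lrho; exists rho => // z.
have [x0 [Lx0 _]] := Lrho 0; have [x [Lx xz]] := Lrho (x0 + z).
exists (x - x0); first by exists x => //; exists x0.
by rewrite -addrA -opprD.
Qed.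

(** A vector of norm [rho] is at distance less than [rho] from some difference,
    which therefore cannot be [0]. *)
Lemma diffset_neq0 L : (0 < d)%N -> relatively_dense L ->
  exists2 w, diffset L w & w != 0.
Proof.
move=> d0 /diffset_relatively_dense[rho rho0 Lrho].
pose z : 'rV[R]_d := delta_mx 0 (Ordinal d0).
have z0 : z != 0.
  apply/eqP => /rowP/(_ (Ordinal d0)); rewrite !mxE !eqxx => /eqP.
  by rewrite oner_eq0.
have [w Lw wz] := Lrho (rho *: ((enorm z)^-1 *: z)).
exists w => //; apply: contraTneq wz => ->.
rewrite sub0r -scaleN1r !enormZ normrN1 mul1r gtr0_norm // -enormZ.
by rewrite (direction_normalize z0) mulr1 ltxx.
Qed.

(** The second direction.  Bounding the angle between [w] and [u] from below
    first leaves only finitely many directions to avoid, namely those of the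
    elements of [L - L] of sup norm at most [5 * D]. *)
Lemma sparse_difference L D u e : relatively_dense L ->
  finite_local_complexity L -> direction u -> direction e -> dot u e = 0 ->
  exists w, [/\ diffset L w, dot w e != 0 &
    forall t, t != 0 -> diffset L (t *: w) -> D <= `|dot (t *: w) e|].
Proof.
move=> /diffset_relatively_dense[rho rho0 Lrho] Lflc u1 e1 ue.
have finB := finite_diffset_bounded (5 * D) Lflc.
have [s [s0 s1 [del del0 sS]]] :=
  finite_set_gap (finite_image (fun b => dot b u / dot b e) finB).
(* [N >= 2 * rho] bounds the norm of [w] by [5 * dot w e], and
   [N - rho > 2 * rho / del] brings its slope within [del] of [s]. *)
pose N := 2 * rho + 2 * rho / del.
have q0 : 0 < rho / del by rewrite divr_gt0.
have [w Lw wz] := Lrho (N *: e + (N * s) *: u).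
set r := w - _ in wz.
have wE : w = r + (N *: e + (N * s) *: u) by rewrite subrK.
have uu : dot u u = 1 by rewrite -sqr_enorm u1 expr1n.
have ee : dot e e = 1 by rewrite -sqr_enorm e1 expr1n.
have re := le_lt_trans (normr_dot_le r e1) wz.
have ru := le_lt_trans (normr_dot_le r u1) wz.
have we : dot w e = dot r e + N.
  by rewrite wE !dotDl !dotZl ee ue mulr0 addr0 mulr1.
have wu : dot w u = dot r u + N * s.
  by rewrite wE !dotDl !dotZl uu (dotC e) ue mulr0 add0r mulr1.
move: re ru; rewrite !ltr_norml => /andP[re1 re2] /andP[ru1 ru2].
have we0 : rho + 2 * (rho / del) < dot w e by rewrite we /N -mulrA; lra.
have wle : `|w| <= 5 * dot w e.
  have e_le := norm_le_enorm e; have u_le := norm_le_enorm u.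
  have N2 : 2 * rho <= N by rewrite /N -mulrA; lra.
  have N0 : 0 <= N by lra.
  rewrite e1 in e_le; rewrite u1 in u_le.
  have Ns : N * s <= N by rewrite ler_piMr.
  have Ns0 : 0 <= N * s by rewrite mulr_ge0.
  have r_le := le_lt_trans (norm_le_enorm r) wz.
  have le1 : `|w| <= `|r| + (N * `|e| + N * s * `|u|).
    rewrite {1}wE (le_trans (ler_normD _ _)) // lerD2l.
    by rewrite (le_trans (ler_normD _ _)) // !normrZ !ger0_norm.
  have le2 : N * `|e| <= N by rewrite ler_piMr.
  have le3 : N * s * `|u| <= N * s by rewrite ler_piMr.
  move: le1 le2 le3 r_le; rewrite we; lra.
exists w; split=> // [|t t0 Lt]; first by rewrite gt_eqF //; lra.
rewrite leNgt; apply/negP => small.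
(* A short multiple of [w] would make the slope of [w] a forbidden one. *)
have /sS : ((fun b => dot b u / dot b e) @` (diffset L `&` [set x | `|x| <= 5 * D]))
    (dot w u / dot w e).
  exists (t *: w); last by rewrite !dotZl -mulf_div divff // mul1r.
  split=> //=; rewrite normrZ.
  move: small; rewrite dotZl normrM (gtr0_norm (_ : 0 < dot w e)); last lra.
  have := normr_ge0 t; nra.
apply/negP; rewrite -ltNge.
have w0 : 0 < dot w e by lra.
have -> : s - dot w u / dot w e = (s * dot w e - dot w u) / dot w e.
  by field; rewrite gt_eqF.
rewrite normrM normfV (gtr0_norm w0) ltr_pdivrMr //.
have : 2 * rho < del * dot w e.
  have -> : 2 * rho = del * (2 * (rho / del)) by field; rewrite gt_eqF.
  by rewrite ltr_pM2l //; lra.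
apply: lt_trans; rewrite we wu ltr_norml; apply/andP; split; nra.
Qed.

(** * Shadows *)

(** Every line parallel to [u] that meets [F] meets [G].  It
    is the common consequence of equal X-rays and of equal projections. *)
Definition shadow_sub u F G := forall x, F x -> exists t, G (x + t *: u).

Lemma shadow_sub_parallel u v F G :
  parallel u v -> shadow_sub v F G -> shadow_sub u F G.
Proof. by move=> [c c0 ->] FG x /FG[t]; rewrite scalerA; exists (t * c). Qed.

(** The two points of [G] seen from [x] along [u] and [w] differ by
    [t *: w - s *: u], whose [e]-component is that of [t *: w]. *)
Lemma two_shadows_sub L D u w e F G : direction e -> dot u e = 0 ->
  (forall t, t != 0 -> diffset L (t *: w) -> D <= `|dot (t *: w) e|) ->
  F `<=` L -> subsets_diam_lt D L G ->
  shadow_sub u F G -> shadow_sub w F G -> F `<=` G.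
Proof.
move=> e1 ue gap FL [GL GD] uFG wFG x Fx.
have [s Gs] := uFG x Fx; have [t Gt] := wFG x Fx.
have [t0|t0] := eqVneq t 0; first by move: Gt; rewrite t0 scale0r addr0.
have Lt : diffset L (t *: w).
  exists (x + t *: w); first exact: GL.
  by exists x; [exact: FL|rewrite addrC addKr].
have := gap t t0 Lt; rewrite leNgt => /negP[].
have -> : dot (t *: w) e = dot ((x + t *: w) - (x + s *: u)) e.
  by rewrite dotBl !dotDl !(dotZl _ u) ue mulr0; ring.
by apply: le_lt_trans (normr_dot_le _ e1) _; exact: (enorm_lt_diam GD).
Qed.

(** The line through a point of [F] has a positive count in [F], hence in [G].
    Finiteness matters, since the count of an infinite set is [0]. *)
Lemma Xray_shadow_sub u F G : finite_set F -> finite_set G ->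
  Xray (u := u) F = Xray G -> shadow_sub u F G.
Proof.
move=> finF finG FG x Fx.
pose l : parallel_line u := exist _ (line_through x u) (ex_intro _ x erefl).
have finI A : finite_set A -> finite_set (A `&` line_through x u).
  by apply: sub_finite_set => y [].
have /(congr1 (fun X => X l)) := FG; rewrite /Xray /= => eqFG.
have : fset_set (G `&` line_through x u) != fset0.
  rewrite -cardfs_eq0 -eqFG cardfs_eq0; apply/fset0Pn; exists x.
  rewrite in_fset_set; last exact: finI.
  by apply/mem_set; split=> //; exists 0 => //; rewrite scale0r addr0.
case/fset0Pn => y; rewrite in_fset_set; last exact: finI.
by move=> /set_mem[Gy [t _ yE]]; exists t; rewrite yE.
Qed.

(** A point of [G] whose projection is that [p] of [x] differs from [p] by a
    vector [z] orthogonal to [orthocompl <[w]>].  The component of [z]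
    orthogonal to [w] is then orthogonal to itself, so [z], and with it the
    difference to [x], is a multiple of [w]. *)
Lemma oproj_shadow_sub w F G : w != 0 ->
  oproj F (orthocompl <[w]>) = oproj G (orthocompl <[w]>) -> shadow_sub w F G.
Proof.
move=> w0 FG x Fx; have ww : dot w w != 0 by apply: contraNneq w0 => /dot_eq0 ->.
have rejE y : orthocompl <[w]> (y - (dot y w / dot w w) *: w).
  move=> _ /vlineP[k ->]; rewrite dotZl dotBr dotZr (dotC w y) divfK //.
  by rewrite subrr mulr0.
set p := x - (dot x w / dot w w) *: w.
have : oproj F (orthocompl <[w]>) p.
  split; first exact: rejE.
  exists x => // s sw; rewrite /p opprB addrC subrK dotZl sw ?mulr0 //.
  exact: memv_line.
rewrite FG => -[_ [y Gy yp]].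
pose z := y - p; pose k := dot z w / dot w w.
have zE : z = k *: w.
  apply/eqP; rewrite -subr_eq0; apply/eqP/dot_eq0.
  rewrite {1}[z - _]/(z - k *: w) dotBl (yp _ (rejE z)) dotZl.
  by rewrite (rejE z) ?memv_line // mulr0 subrr.
exists (k - dot x w / dot w w).
by rewrite scalerBl -zE /z /p opprD opprK !addrA addrK addrAC subrr add0r.
Qed.

End Euclidean.

(** * Determination by two directions *)

Theorem theorem13 (R : realType) (d : nat) (hd : (2 <= d)%N) (D : R)
    (hD : 0 < D) (L : set 'rV[R]_d) (hL : Delone L)
    (hflc : finite_local_complexity L) :
  determined_by_Xrays 2 L (subsets_diam_lt D L) /\
  determined_by_projections 2 L (subsets_diam_lt D L).
Proof.
have [_ Ld] := hL.
have [v Lv v0] := diffset_neq0 (ltnW hd) Ld.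
have [e e1 ve] := exists_orthogonal_direction v hd.
have ue : dot ((enorm v)^-1 *: v) e = 0 by rewrite dotZl ve mulr0.
have [w [Lw we gap]] := sparse_difference D Ld hflc (direction_normalize v0) e1 ue.
have w0 : w != 0.
  by apply: contraNneq we => ->; rewrite -(scale0r e) dotZl mul0r.
have key F G : subsets_diam_lt D L F -> subsets_diam_lt D L G ->
    shadow_sub v F G -> shadow_sub w F G -> F `<=` G.
  by move=> FD; apply: two_shadows_sub e1 ve gap (FD.1).
split.
- have pv := parallel_normalize v0; have pw := parallel_normalize w0.
  set v' := _ *: v in pv ue *; set w' := _ *: w in pw.
  have we' : dot w' e != 0.
    by rewrite dotZl mulf_neq0 // invr_eq0 enorm_neq0.
  have npar' : ~ parallel v' w'.
    by case=> c _ wE; move: we'; rewrite wE dotZl ue mulr0 eqxx.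
  exists [set v'; w']; split.
  + by apply: card_eq_set2; apply: contraNneq we' => <-; rewrite ue.
  + by move=> _ [->|->]; (split; first exact: direction_normalize);
      [exists v|exists w]; split=> //; exact: parallel_sym.
  + by move=> _ _ [->|->] [->|->] // _ => /parallel_sym.
  + move=> F G FD GD FG.
    have finF := finite_subset_diam_lt hflc FD.
    have finG := finite_subset_diam_lt hflc GD.
    have FGv := FG v' (or_introl erefl); have FGw := FG w' (or_intror erefl).
    by apply/seteqP; split; apply: key => //;
      [apply: shadow_sub_parallel pv _|apply: shadow_sub_parallel pw _
      |apply: shadow_sub_parallel pv _|apply: shadow_sub_parallel pw _];
      apply: Xray_shadow_sub.
- have nvw : ~~ parallel_subspaces <[v]> <[w]>.
    apply/negP => /orP[] /subvP/(_ _ (memv_line _))/vlineP[k kE].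
      move: ve v0; rewrite kE dotZl => /eqP.
      by rewrite mulf_eq0 (negbTE we) orbF => /eqP ->; rewrite scale0r eqxx.
    by move: we; rewrite kE dotZl ve mulr0 eqxx.
  exists [set <[v]>%VS; <[w]>%VS]; split.
  + by apply: card_eq_set2; apply: contraNneq nvw => ->;
      rewrite /parallel_subspaces subvv.
  + by move=> _ [->|->]; rewrite dim_vline ?v0 ?w0; split=> //;
      [exists [:: v]|exists [:: w]]; rewrite ?span_seq1 // => x;
      rewrite inE => /eqP ->.
  + move=> _ _ [->|->] [->|->] // _; by rewrite /parallel_subspaces orbC.
  + move=> F G FD GD FG.
    have FGv := FG _ (or_introl erefl); have FGw := FG _ (or_intror erefl).
    by apply/seteqP; split; apply: key => //; apply: oproj_shadow_sub.
Qed.
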